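(* (a) Let $L$ be a Leibniz ring whose additive group is infinite cyclic. Then $[x,y]=0$ for all $x,y\in L$. (b) Let $p$ be a prime, $m$ a positive integer, and let $L$ be a Leibniz ring whose additive group is cyclic of order $p^m$. Suppose that $L$ is not a Lie ring. Then there exist a generator $g$ of the additive group of $L$ and a non-negative integer $s$ with $2s\leq m$ such that, putting $c=[g,g]$, one has $c=p^{m-s}g$, the element $c$ has additive order $p^s$, and $[g,c]=[c,g]=0$. Moreover $$Leib(L)=[L,L]=\langle p^{m-s}g\rangle,\qquad \zeta^{\mathrm{right}}(L)=\zeta^{\mathrm{left}}(L)=\zeta(L)=\langle p^{s}g\rangle.$$ (c) Conversely, let $p$ be a prime, $m$ a positive integer, $s$ a non-negative integer with $2s\leq m$, let $L=\langle g\rangle$ be an additive cyclic group of order $p^m$, and put $c=p^{m-s}g$. Then the multiplication $[n_1g,n_2g]=n_1n_2c$ (for non-negative integers $n_1,n_2$) makes $L$ a Leibniz ring.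
   Context: A (left) Leibniz ring is a set $L$ with binary operations $+$ and $[,]$ such that $L$ is an abelian group under $+$, the operation $[,]$ is additive in each argument, and $[a,[b,c]]=[[a,b],c]+[b,[a,c]]$ for all $a,b,c\in L$. A Lie ring is an abelian group with a biadditive bracket $[,]$ such that $[a,a]=0$ and $[[a,b],c]+[[b,c],a]+[[c,a],b]=0$ for all $a,b,c$. $\langle\cdot\rangle$ denotes the additive subgroup generated. $[L,L]$ is the additive subgroup generated by all $[a,b]$, $a,b\in L$; $Leib(L)$ is the additive subgroup generated by all $[a,a]$, $a\in L$. Further, $\zeta^{\mathrm{left}}(L)=\{x\in L\mid [x,y]=0\text{ for all }y\in L\}$, $\zeta^{\mathrm{right}}(L)=\{x\in L\mid [y,x]=0\text{ for all }y\in L\}$, $\zeta(L)=\zeta^{\mathrm{left}}(L)\cap\zeta^{\mathrm{right}}(L)$. The additive order of an element is its order in the additive group of $L$. *)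

(* Defs.v *)
From HB Require Import structures.
From mathcomp Require Import all_boot all_order all_algebra.
From mathcomp Require Import all_fingroup all_solvable.

Set Implicit Arguments.
Unset Strict Implicit.
Unset Printing Implicit Defensive.

Import GRing.Theory.
Local Open Scope ring_scope.

Definition biadditive (L : zmodType) (br : L -> L -> L) : Prop :=
  (forall a b c, br (a + b) c = br a c + br b c) /\
  (forall a b c, br a (b + c) = br a b + br a c).

(* Left Leibniz rings: left multiplications are derivations. *)
Definition leibniz_ring (L : zmodType) (br : L -> L -> L) : Prop :=
  biadditive br /\
  (forall a b c, br a (br b c) = br (br a b) c + br b (br a c)).

Definition lie_ring (L : zmodType) (br : L -> L -> L) : Prop :=
  [/\ biadditive br,
      forall a, br a a = 0 &
      forall a b c, br (br a b) c + br (br b c) a + br (br c a) b = 0].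

Definition infinite_type (T : eqType) : Prop :=
  ~ exists s : seq T, forall x, x \in s.

(* The predicate [cyclic] of the library is restricted to finite groups. *)
Definition infinite_cyclic (L : zmodType) : Prop :=
  (exists g : L, forall x, exists n : int, x = g *~ n) /\ infinite_type L.

(* A finZmodType is canonically a finGroupType whose (multiplicatively
   written) law is addition, so <<A>> is the additive subgroup generated
   by A, and <[x]>, #[x], cyclic and generator are additive notions too. *)

Definition leibniz_kernel (L : finZmodType) (br : L -> L -> L) : {set L} :=
  <<[set br a a | a : L]>>%g.

Definition leibniz_derived (L : finZmodType) (br : L -> L -> L) : {set L} :=
  <<[set br a b | a : L, b : L]>>%g.

Definition leibniz_left_center (L : finZmodType) (br : L -> L -> L) : {set L} :=
  [set x | [forall y, br x y == 0]].

Definition leibniz_right_center (L : finZmodType) (br : L -> L -> L) : {set L} :=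
  [set x | [forall y, br y x == 0]].

Definition leibniz_center (L : finZmodType) (br : L -> L -> L) : {set L} :=
  leibniz_left_center br :&: leibniz_right_center br.

(* Main.v *)
Require Import Defs.
From HB Require Import structures.
From mathcomp Require Import all_boot all_order all_algebra.
From mathcomp Require Import all_fingroup all_solvable.

(* If g generates L additively and [g, g] = k g, the Leibniz identity at
   (g, g, g) gives [[g, g], g] = k^2 g = 0.  In the infinite case this forces
   k = 0.  When L has order p^m, write k = p^t u with u prime to p; then
   m <= 2t.  If t >= m, all brackets vanish and s = 0; otherwise replacing g by
   v g with u v = 1 mod p^m normalises [g, g] to p^t g, and s = m - t.  All
   brackets are then multiples of c = [g, g], and n g is central exactly when
   p^s divides n. *)

Set Implicit Arguments.
Unset Strict Implicit.
Unset Printing Implicit Defensive.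

Import GRing.Theory.
Local Open Scope ring_scope.

(** * Biadditive brackets and the infinite cyclic case *)

Lemma biadditive_mulz (L : zmodType) (br : L -> L -> L) (x y : L) (a b : int) :
  biadditive br -> br (x *~ a) (y *~ b) = br x y *~ (a * b).
Proof.
move=> [brDl brDr].
have brBl z : {morph br^~ z : u v / u - v}.
  by move=> u v /=; apply: (addIr (br v z)); rewrite -brDl !subrK.
have brBr z : {morph br z : u v / u - v}.
  by move=> u v /=; apply: (addIr (br z v)); rewrite -brDr !subrK.
(* Each partial map of the bracket is packaged as an additive morphism, so that integer multiples
   can be pulled out one argument at a time. *)
pose fl : {additive L -> L} :=
  HB.pack (br^~ (y *~ b)) (GRing.isZmodMorphism.Build L L _ (brBl _)).
pose fr : {additive L -> L} :=
  HB.pack (br x) (GRing.isZmodMorphism.Build L L _ (brBr _)).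
rewrite -[LHS]/(fl (x *~ a)) raddfMz -[fl x]/(fr (y *~ b)) raddfMz.
by rewrite mulrC mulrzA.
Qed.

Lemma biadditive_muln (L : zmodType) (br : L -> L -> L) (x y : L) (a b : nat) :
  biadditive br -> br (x *+ a) (y *+ b) = br x y *+ (a * b).
Proof. exact: (@biadditive_mulz L br x y a b). Qed.

(** At the triple (x, x, x) the term [br x (br x x)] occurs on both sides of the Leibniz identity
    and cancels. *)
Lemma leibniz_square_left (L : zmodType) (br : L -> L -> L) (x : L) :
  leibniz_ring br -> br (br x x) x = 0.
Proof.
by case=> _ leib; apply: (addIr (br x (br x x))); rewrite -leib add0r.
Qed.

(** If a nonzero [k] killed [g], reducing coefficients modulo [k] would list all of [L] among the
    multiples of [g] by 0, ..., |k| - 1. *)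
Lemma infinite_cyclic_torsion_free (L : zmodType) (g : L) (k : int) :
  (forall x, exists n : int, x = g *~ n) -> infinite_type L ->
  g *~ k = 0 -> k = 0.
Proof.
move=> genL infL gk0; apply/eqP/negPn/negP => k_neq0; apply: infL.
exists [seq g *+ i | i <- iota 0 `|k|%N] => x.
have [n ->] := genL x.
have rem_ge0 : (0 <= n %% k)%Z by rewrite modz_ge0.
apply/mapP; exists `|(n %% k)%Z|%N.
  by rewrite mem_iota /= add0n -ltz_nat gez0_abs // ltz_mod.
rewrite -[RHS]/(g *~ `|(n %% k)%Z|%N) gez0_abs // {1}(divz_eq n k).
by rewrite mulrzDr mulrC mulrzA gk0 mul0rz add0r.
Qed.

Lemma leibniz_infinite_cyclic (L : zmodType) (br : L -> L -> L) :
  leibniz_ring br -> infinite_cyclic L -> forall x y : L, br x y = 0.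
Proof.
move=> leib [[g genL] infL] x y; have bi := leib.1.
have [k gg] := genL (br g g).
have /(infinite_cyclic_torsion_free genL infL)/eqP : g *~ (k * k) = 0.
  have := leibniz_square_left g leib.
  by rewrite gg -[X in br _ X]mulr1z biadditive_mulz // mulr1 gg -mulrzA.
rewrite mulf_eq0 orbb => /eqP k0.
have [[a ->] [b ->]] := (genL x, genL y).
by rewrite biadditive_mulz // gg k0 mulr0z mul0rz.
Qed.

(** * Finite cyclic additive groups *)

Lemma zmod_generatorP (L : finZmodType) (g : L) :
  generator [set: L] g -> forall x, exists n, x = g *+ n.
Proof.
move=> /eqP gen x; have : x \in <[g]>%g by rewrite -gen inE.
by case/cycleP=> n ->; exists n; rewrite FinRing.zmodXgE.
Qed.

Lemma zmod_order_dvdn (L : finZmodType) (x : L) n :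
  (x *+ n == 0) = (#[x]%g %| n)%N.
Proof. by rewrite order_dvdn FinRing.zmodXgE. Qed.

Lemma generator_card (L : finZmodType) (g : L) :
  generator [set: L] g -> #[g]%g = #|L|.
Proof. by move=> /eqP gen; rewrite orderE -gen cardsT. Qed.

(** * The product on a cyclic group of order p^m with [g, g] = p^(m-s) g *)

Section NormalisedProduct.

Variables (p m s : nat) (L : finZmodType) (br : L -> L -> L) (g : L).
Hypotheses (p_pr : prime p) (s2_le : (2 * s <= m)%N).
Hypotheses (genL : generator [set: L] g) (cardL : #|L| = (p ^ m)%N).

Local Notation c := (g *+ (p ^ (m - s))).

Let s_le : (s <= m)%N.
Proof. by apply: leq_trans s2_le; rewrite mul2n -addnn leq_addr. Qed.

Lemma order_generator_exp (t : nat) :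
  (t <= m)%N -> #[g *+ (p ^ (m - t))]%g = (p ^ t)%N.
Proof.
move=> t_le; have og := generator_card genL; rewrite cardL in og.
rewrite -FinRing.zmodXgE orderXdiv og ?dvdn_exp2l ?leq_subr //.
by rewrite -expnB ?prime_gt0 ?leq_subr // subKn.
Qed.

(** This is where 2s <= m enters: [c] has order p^s, and s <= m - s. It makes every triple product
    vanish. *)
Lemma normalised_square_mulrn : c *+ (p ^ (m - s)) = 0.
Proof.
apply/eqP; rewrite zmod_order_dvdn order_generator_exp //.
by rewrite dvdn_exp2l // leq_subRL // addnn -mul2n.
Qed.

(** This rule serves both directions: a given Leibniz ring satisfies it once [br g g = c], and in
    the converse it is the definition of the product. *)
Hypothesis (brE : forall a b, br (g *+ a) (g *+ b) = c *+ (a * b)).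

(** Biadditivity is distributivity of the coefficients. All three terms of the Leibniz identity are
    multiples of p^(m-s) c, hence zero. *)
Lemma leibniz_normalised : leibniz_ring br.
Proof.
split; first split.
- move=> x y z; have gP := zmod_generatorP genL.
  have [[[i ->] [j ->]] [k ->]] := (gP x, gP y, gP z).
  by rewrite -mulrnDr !brE mulnDl mulrnDr.
- move=> x y z; have gP := zmod_generatorP genL.
  have [[[i ->] [j ->]] [k ->]] := (gP x, gP y, gP z).
  by rewrite -mulrnDr !brE mulnDr mulrnDr.
have cK n : c *+ (p ^ (m - s) * n) = 0.
  by rewrite mulrnA normalised_square_mulrn mul0rn.
move=> x y z; have gP := zmod_generatorP genL.
have [[[i ->] [j ->]] [k ->]] := (gP x, gP y, gP z).
rewrite !brE -!mulrnA !brE.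
rewrite [(i * (p ^ _ * _))%N]mulnCA [(j * (p ^ _ * _))%N]mulnCA.
by rewrite -[(p ^ _ * _ * k)%N]mulnA !cK addr0.
Qed.

Let gg : br g g = c.
Proof. exact: (brE 1 1). Qed.

Lemma normalised_bracket_generator : br g c = 0 /\ br c g = 0.
Proof.
split.
  by have := brE 1 (p ^ (m - s)); rewrite mul1n normalised_square_mulrn.
by have := brE (p ^ (m - s)) 1; rewrite muln1 normalised_square_mulrn.
Qed.

Lemma normalised_derived : leibniz_derived br = <[c]>%g.
Proof.
apply/eqP; rewrite eqEsubset gen_subG cycle_subG; apply/andP; split.
  apply/subsetP=> _ /imset2P[x y _ _ ->]; have gP := zmod_generatorP genL.
  have [[i ->] [j ->]] := (gP x, gP y).
  by rewrite brE -[c *+ (i * j)]FinRing.zmodXgE mem_cycle.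
by rewrite mem_gen // -gg; apply/imset2P; exists g g.
Qed.

(** The derived subgroup is generated by [c], which is itself the square [g, g]. *)
Lemma normalised_kernel : leibniz_kernel br = leibniz_derived br.
Proof.
apply/eqP; rewrite eqEsubset; apply/andP; split.
  rewrite genS //; apply/subsetP=> _ /imsetP[x _ ->].
  by apply/imset2P; exists x x.
by rewrite normalised_derived cycle_subG mem_gen // -gg; apply/imsetP; exists g.
Qed.

(** Both sides say that p^s divides [n]. From left to right, a congruence modulo p^m is reduced
    modulo its divisor p^s. *)
Let mem_central n : (g *+ n \in <[g *+ (p ^ s)]>%g) = (c *+ n == 0).
Proof.
have og := generator_card genL; rewrite cardL in og.
rewrite zmod_order_dvdn order_generator_exp //; apply/idP/idP.
  case/cycleP=> k; rewrite FinRing.zmodXgE -mulrnA -!FinRing.zmodXgE => /eqP.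
  rewrite eq_expg_mod_order og => /eqP/(congr1 (modn^~ (p ^ s)%N)).
  by rewrite !modn_dvdm ?dvdn_exp2l // modnMr /dvdn => ->.
by case/dvdnP=> k ->; rewrite mulnC mulrnA -[_ *+ k]FinRing.zmodXgE mem_cycle.
Qed.

(** Testing against [g] alone suffices: [n g, g] = n c, and every [n g, y] is a multiple of it. *)
Lemma normalised_left_center : leibniz_left_center br = <[g *+ (p ^ s)]>%g.
Proof.
apply/setP=> x; have gP := zmod_generatorP genL; have [n ->] := gP x.
rewrite inE mem_central; apply/forallP/eqP => [/(_ g)/eqP | cn0 y].
  by rewrite -[X in br _ X]mulr1n brE muln1.
by have [k ->] := gP y; rewrite brE mulrnA cn0 mul0rn.
Qed.

Lemma normalised_right_center : leibniz_right_center br = <[g *+ (p ^ s)]>%g.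
Proof.
apply/setP=> x; have gP := zmod_generatorP genL; have [n ->] := gP x.
rewrite inE mem_central; apply/forallP/eqP => [/(_ g)/eqP | cn0 y].
  by rewrite -[X in br X _]mulr1n brE mul1n.
by have [k ->] := gP y; rewrite brE mulnC mulrnA cn0 mul0rn.
Qed.

End NormalisedProduct.

(** * Normalising the generator *)

Lemma leibniz_cyclic_normalise (p m : nat) (L : finZmodType)
    (br : L -> L -> L) :
  prime p -> leibniz_ring br -> cyclic [set: L] -> #|L| = (p ^ m)%N ->
  exists g s, [/\ generator [set: L] g, (2 * s <= m)%N &
                  br g g = g *+ (p ^ (m - s))].
Proof.
move=> p_pr leib /cyclicP[h hgen] cardL; have bi := leib.1.
have genh : generator [set: L] h by rewrite /generator hgen.
have oh := generator_card genh; rewrite cardL in oh.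
have hP n : (h *+ n == 0) = (p ^ m %| n)%N by rewrite zmod_order_dvdn oh.
have pm_gt0 : (0 < p ^ m)%N by rewrite expn_gt0 prime_gt0.
(* Shifting k by p ^ m makes it positive, so that it has a p-part even when
   the product is zero. *)
have [k k_gt0 hh] : exists2 k, (0 < k)%N & br h h = h *+ k.
  have [n ->] := zmod_generatorP genh (br h h).
  exists (n + p ^ m)%N; first by rewrite addn_gt0 pm_gt0 orbT.
  have /eqP pm0 : h *+ (p ^ m) == 0 by rewrite hP.
  by rewrite mulrnDr pm0 addr0.
have kk : (p ^ m %| k * k)%N.
  rewrite -hP mulrnA -hh.
  have := leibniz_square_left h leib.
  by rewrite {1}hh -[X in br _ X]mulr1n biadditive_muln // muln1 => ->.
have [t [u [up def_k]]] : exists t u, coprime p u /\ k = (u * p ^ t)%N.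
  have [u up def_k] := pfactor_coprime p_pr k_gt0.
  by exists (logn p k), u.
have u_gt0 : (0 < u)%N by move: k_gt0; rewrite def_k muln_gt0 => /andP[].
(* Compare exponents of p in p^m | k^2, where [k] has exponent [t]. *)
have m_le : (m <= 2 * t)%N.
  move: kk; rewrite pfactor_dvdn ?muln_gt0 ?k_gt0 // lognM // addnn -mul2n.
  rewrite def_k lognM // ?expn_gt0 ?prime_gt0 // pfactorK //.
  by rewrite (logn_coprime up).
have [v vu] : exists v, v * u = 1 %[mod p ^ m].
  have cop : coprime u (p ^ m) by rewrite coprime_sym coprimeXl.
  have [v kn def1 _] := egcdnP (p ^ m) u_gt0.
  by exists v; rewrite def1 (eqP cop) modnMDl.
have cop_v : coprime (p ^ m) v.
  have : coprime (p ^ m) (v * u).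
    by rewrite -coprime_modr vu coprime_modr coprimen1.
  by rewrite coprimeMr => /andP[].
(* The cases differ because [m - (m - t)] equals [t] only for t <= m, subtraction being truncated;
   for t >= m both [h, h] and p^m h are zero. *)
have [m_le_t | t_lt] := leqP m t.
  exists h, 0%N; split; rewrite ?muln0 // hh subn0; apply/eqP.
  have /eqP -> : h *+ (p ^ m) == 0 by rewrite hP.
  by rewrite hP def_k dvdn_mull // dvdn_exp2l.
exists (h *+ v), (m - t)%N; split.
- by rewrite -FinRing.zmodXgE hgen generator_coprime oh.
- by rewrite mulnBr leq_subLR [(2 * m)%N]mul2n -addnn leq_add2r.
rewrite biadditive_muln // hh subKn ?(ltnW t_lt) // -!mulrnA -!FinRing.zmodXgE.
apply/eqP; rewrite eq_expg_mod_order oh def_k.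
(* Rescaling by [v] multiplies the square by v^2; one factor [v] cancels [u] modulo p^m and the
   other belongs to the new generator. *)
have -> : (u * p ^ t * (v * v) = v * u * (v * p ^ t))%N
  by rewrite mulnACA [(u * v)%N]mulnC [(p ^ t * v)%N]mulnC.
by rewrite -modnMml vu modnMml mul1n.
Qed.

Theorem mainTheorem1 :
  (forall (L : zmodType) (br : L -> L -> L),
     leibniz_ring br -> infinite_cyclic L ->
     forall x y : L, br x y = 0)
  /\
  (forall (p m : nat) (L : finZmodType) (br : L -> L -> L),
     prime p -> (0 < m)%N ->
     leibniz_ring br -> cyclic [set: L] -> #|L| = (p ^ m)%N ->
     ~ lie_ring br ->
     exists (g : L) (s : nat),
       let c := br g g in
       [/\ generator [set: L] g, (2 * s <= m)%N,
           c = g *+ (p ^ (m - s))%N, #[c]%g = (p ^ s)%N &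
           br g c = 0 /\ br c g = 0]
       /\ [/\ leibniz_kernel br = leibniz_derived br,
              leibniz_derived br = <[g *+ (p ^ (m - s))%N]>%g,
              leibniz_right_center br = leibniz_left_center br,
              leibniz_left_center br = leibniz_center br &
              leibniz_center br = <[g *+ (p ^ s)%N]>%g])
  /\
  (forall (p m s : nat) (L : finZmodType) (g : L),
     prime p -> (0 < m)%N -> (2 * s <= m)%N ->
     generator [set: L] g -> #|L| = (p ^ m)%N ->
     let c := g *+ (p ^ (m - s))%N in
     let is_mult (br : L -> L -> L) :=
       forall n1 n2 : nat, br (g *+ n1) (g *+ n2) = c *+ (n1 * n2)%N in
     (exists br : L -> L -> L, is_mult br) /\
     (forall br : L -> L -> L, is_mult br -> leibniz_ring br)).
Proof.
split; first exact: leibniz_infinite_cyclic.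
split.
  move=> p m L br p_pr _ leib cycL cardL _.
  have [g [s [genL s2_le gg]]] :=
    leibniz_cyclic_normalise p_pr leib cycL cardL.
  have brE a b : br (g *+ a) (g *+ b) = g *+ (p ^ (m - s)) *+ (a * b).
    by rewrite biadditive_muln ?gg //; exact: leib.1.
  have s_le : (s <= m)%N.
    by apply: leq_trans s2_le; rewrite mul2n -addnn leq_addr.
  exists g, s => c; split; split; rewrite /c ?gg //.
  - exact: order_generator_exp.
  - exact: normalised_bracket_generator brE.
  - exact: normalised_kernel brE.
  - exact: normalised_derived brE.
  - by rewrite (normalised_right_center p_pr s2_le genL cardL brE)
      (normalised_left_center p_pr s2_le genL cardL brE).
  - by rewrite /leibniz_center
      (normalised_right_center p_pr s2_le genL cardL brE)
      (normalised_left_center p_pr s2_le genL cardL brE) setIid.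
  - by rewrite /leibniz_center
      (normalised_right_center p_pr s2_le genL cardL brE)
      (normalised_left_center p_pr s2_le genL cardL brE) setIid.
move=> p m s L g p_pr _ s2_le genL cardL c is_mult; split; last first.
  by move=> br brE; apply: leibniz_normalised brE.
(* The product is built from one chosen coefficient per element. *)
have /fin_all_exists[coef coefK] := zmod_generatorP genL.
exists (fun x y => c *+ (coef x * coef y)) => a b.
(* Independence of the choice: with p^(m-s) moved outermost, each chosen coefficient can act
   directly on [g], where [coefK] gives back the element. *)
rewrite /c -!mulrnA ![(p ^ _ * _)%N]mulnC !mulrnA; congr (_ *+ _).
by rewrite -coefK [LHS]mulrnAC -coefK mulrnAC.
Qed.
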